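(* For integers $2\leq m\leq n$, $\gamma_{P,c}(K_m\,\square\,K_n)=m-1$.
   Context: Power domination: for $S\subseteq V(G)$, start with $M(S)=N[S]$ and repeatedly add a vertex $w$ whenever some $v\in M(S)$ has $w$ as its unique neighbour outside $M(S)$; $S$ is a connected power dominating set if the final $M(S)$ is $V(G)$ and $\langle S\rangle$ is connected; $\gamma_{P,c}(G)$ is the minimum size of such a set. The Cartesian product $G\,\square\,H$ has vertex set $V(G)\times V(H)$, with $(a,b)\sim(x,y)$ iff either $a=x$ and $by\in E(H)$, or $b=y$ and $ax\in E(G)$. $K_n$ is the complete graph on $n$ vertices. *)

(* Defs.v *)
From mathcomp Require Import all_boot.
Set Implicit Arguments.
Unset Strict Implicit.
Unset Printing Implicit Defensive.

Record sgraph := SGraph {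
  vertex :> finType;
  adj : rel vertex;
  adj_sym : symmetric adj;
  adj_irrefl : irreflexive adj }.

Definition nbhd (G : sgraph) (v : G) : {set G} := [set w | adj v w].

Definition closed_nbhd (G : sgraph) (S : {set G}) : {set G} :=
  S :|: \bigcup_(v in S) nbhd v.

Definition forces (G : sgraph) (M : {set G}) (v w : G) : bool :=
  (v \in M) && (nbhd v :\: M == [set w]).

Definition monitor_round (G : sgraph) (M : {set G}) : {set G} :=
  M :|: [set w | [exists v, forces M v w]].

(* All vertices that can be forced are added simultaneously in each round; the
   process is stationary after at most #|G| rounds (monitored_stuck), and adding
   the vertices one at a time, in any order, ends in the same set
   (monitored_unique). *)
Definition monitored (G : sgraph) (S : {set G}) : {set G} :=
  iter #|G| (@monitor_round G) (closed_nbhd S).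

Definition power_dominating (G : sgraph) (S : {set G}) : bool :=
  monitored S == setT.

Definition induced_connected (G : sgraph) (S : {set G}) : bool :=
  [forall x in S, forall y in S,
     connect [rel u v : G | [&& u \in S, v \in S & adj u v]] x y].

Definition connected_power_dominating (G : sgraph) (S : {set G}) : bool :=
  power_dominating S && induced_connected S.

(* For connected G this is the minimum size (gammaPcP). A disconnected graph has
   no connected power dominating set, and the value is then the default #|G|. *)
Definition gammaPc (G : sgraph) : nat :=
  #|[arg min_(S < [set: G] | connected_power_dominating S) #|S|]|.

Lemma complete_sym (n : nat) : symmetric (fun i j : 'I_n => i != j).
Proof. by move=> i j; rewrite eq_sym. Qed.

Lemma complete_irrefl (n : nat) : irreflexive (fun i j : 'I_n => i != j).
Proof. by move=> i; rewrite eqxx. Qed.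

Definition complete (n : nat) : sgraph :=
  SGraph (@complete_sym n) (@complete_irrefl n).

Definition cart_adj (G H : sgraph) : rel (G * H) := fun u v =>
  ((u.1 == v.1) && adj u.2 v.2) || ((u.2 == v.2) && adj u.1 v.1).

Lemma cart_sym (G H : sgraph) : symmetric (@cart_adj G H).
Proof.
move=> u v; rewrite /cart_adj (eq_sym u.1) (eq_sym u.2).
by rewrite (adj_sym u.1) (adj_sym u.2).
Qed.

Lemma cart_irrefl (G H : sgraph) : irreflexive (@cart_adj G H).
Proof. by move=> u; rewrite /cart_adj !adj_irrefl !andbF. Qed.

Definition cartesian (G H : sgraph) : sgraph :=
  SGraph (@cart_sym G H) (@cart_irrefl G H).

Lemma monitor_round_sub (G : sgraph) (M : {set G}) : M \subset monitor_round M.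
Proof. exact: subsetUl. Qed.

Lemma monitored_fixed (G : sgraph) (S : {set G}) :
  monitor_round (monitored S) = monitored S.
Proof.
rewrite /monitored; set f := @monitor_round G; set A := closed_nbhd S.
have fixP k : f (iter k f A) = iter k f A \/ k <= #|iter k f A|.
  elim: k => [|k [IH|IH]]; [by right | by left; rewrite /= !IH |].
  have [E|NE] := eqVneq (f (iter k f A)) (iter k f A).
    by left; rewrite /= !E.
  right; apply: leq_ltn_trans IH _; apply: proper_card.
  by rewrite properEneq eq_sym NE monitor_round_sub.
have [//|le] := fixP #|G|.
have /eqP -> : iter #|G| f A == setT by rewrite eqEcard subsetT cardsT.
by apply/eqP; rewrite eqEsubset subsetT monitor_round_sub.
Qed.

Lemma monitored_stuck (G : sgraph) (S : {set G}) (v w : G) :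
  ~~ forces (monitored S) v w.
Proof.
apply/negP => Hf; have /andP[_ /eqP E] := Hf.
have: w \in nbhd v :\: monitored S by rewrite E set11.
rewrite inE -monitored_fixed !inE negb_or => /andP[/andP[_ /negP nf] _].
by apply: nf; apply/existsP; exists v.
Qed.

Inductive sequential_run (G : sgraph) (S : {set G}) : {set G} -> Prop :=
| RunStart : sequential_run S (closed_nbhd S)
| RunForce (M : {set G}) (v w : G) :
    sequential_run S M -> forces M v w -> sequential_run S (w |: M).

Lemma forces_mono (G : sgraph) (M F : {set G}) (v w : G) :
  M \subset F -> (forall x y : G, ~~ forces F x y) -> forces M v w -> w \in F.
Proof.
move=> sMF stuck /andP[vM /eqP E]; apply/negPn/negP => wF.
have: w \in nbhd v :\: M by rewrite E set11.
rewrite in_setD => /andP[_ vw].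
have /negP[] := stuck v w; rewrite /forces (subsetP sMF _ vM) eqEsubset /=.
by rewrite sub1set in_setD wF vw andbT -E setDS.
Qed.

Lemma monitored_unique (G : sgraph) (S M : {set G}) :
  sequential_run S M -> (forall v w : G, ~~ forces M v w) -> M = monitored S.
Proof.
move=> run stuck; apply/eqP; rewrite eqEsubset; apply/andP; split.
  elim: M / run {stuck} => [|M v w _ IH F].
    rewrite /monitored; elim: #|G| => //= k /subset_trans; apply.
    exact: monitor_round_sub.
  by rewrite subUset IH sub1set (forces_mono IH (@monitored_stuck _ _) F).
have sAM : closed_nbhd S \subset M.
  elim: M / run {stuck} => // M v w _ /subset_trans H _.
  by apply: H; apply: subsetUr.
rewrite /monitored; elim: #|G| => //= k IH; rewrite subUset IH /=.
by apply/subsetP => w; rewrite inE => /existsP[v]; apply: forces_mono.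
Qed.

Lemma connected_power_dominatingT (G : sgraph) :
  (forall x y : G, connect (@adj G) x y) ->
  connected_power_dominating [set: G].
Proof.
move=> conn; apply/andP; split.
  rewrite /power_dominating /monitored; elim: #|G| => [|k /eqP IH] /=.
    by rewrite /closed_nbhd setTU.
  by rewrite IH /monitor_round setTU.
apply/forall_inP => x _; apply/forall_inP => y _.
by rewrite (eq_connect (e' := @adj G)) // => u v /=; rewrite !inE.
Qed.

Lemma gammaPcP (G : sgraph) :
  (forall x y : G, connect (@adj G) x y) ->
  (exists2 S : {set G}, connected_power_dominating S & #|S| = gammaPc G) /\
  (forall S : {set G}, connected_power_dominating S -> gammaPc G <= #|S|).
Proof.
move=> conn; rewrite /gammaPc.
case: arg_minnP => [|S cS minS]; first exact: connected_power_dominatingT.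
by split=> //; exists S.
Qed.

(* Main.v *)
Require Import Defs.
From mathcomp Require Import all_boot.

(** In the grid K_m x K_n the closed neighbourhood of [S] is the union of the
    rows and columns meeting [S].  If at least two rows and two columns miss [S],
    this union is stuck: a monitored vertex with an unmonitored neighbour lies in
    exactly one of a missed row and a missed column, and has a second unmonitored
    neighbour there.  So [S] meets all rows but one or all columns but one.
    Conversely, taking all but one vertex of a single column leaves only one row
    to be forced, each of its vertices through its own column. *)

(** Forcing is monotone, so no round can leave a stuck set; this bounds the final set from above. *)
Lemma monitored_sub {G : sgraph} {S F : {set G}} :
  closed_nbhd S \subset F -> (forall v w : G, ~~ forces F v w) ->
  monitored S \subset F.
Proof.
move=> sSF stuck; rewrite /monitored; elim: #|G| => //= k IH.
rewrite subUset IH; apply/subsetP => w; rewrite inE => /existsP[v].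
exact: forces_mono.
Qed.

Lemma sub_monitored {G : sgraph} (S : {set G}) : closed_nbhd S \subset monitored S.
Proof.
rewrite /monitored; elim: #|G| => //= k /subset_trans; apply.
exact: monitor_round_sub.
Qed.

Lemma exists_other {T : finType} {A : {set T}} (x : T) :
  1 < #|A| -> exists2 y, y \in A & y != x.
Proof.
case/card_gt1P=> y [z [yA zA neq_yz]].
have [eq_yx|neq_yx] := eqVneq y x; last by exists y.
by exists z; rewrite // -eq_yx eq_sym.
Qed.

Section RookGraph.

Variables m n : nat.
Local Notation K := (cartesian (complete m) (complete n)).

Definition cross (A : {set 'I_m}) (B : {set 'I_n}) : {set K} :=
  [set v : K | (v.1 \in A) || (v.2 \in B)].

Lemma closed_nbhd_sub_cross (S : {set K}) :
  closed_nbhd S \subset cross [set v.1 | v in S] [set v.2 | v in S].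
Proof.
rewrite subUset; apply/andP; split; apply/subsetP => v.
  by move=> vS; rewrite inE (imset_f (fun u : K => u.1)).
case/bigcupP=> u uS; rewrite !inE => /orP[] /andP[/eqP <- _].
  by rewrite (imset_f (fun u : K => u.1)).
by rewrite (imset_f (fun u : K => u.2)) ?orbT.
Qed.

Lemma cross_stuck {A : {set 'I_m}} {B : {set 'I_n}} (v w : K) :
  1 < #|~: A| -> 1 < #|~: B| -> ~~ forces (cross A B) v w.
Proof.
case: v w => [i j] [x y] cA cB; apply/negP => /andP[vF /eqP E].
have : (x, y) \in nbhd ((i, j) : K) :\: cross A B by rewrite E set11.
rewrite !inE /= negb_or => /andP[/andP[xA yB]] /orP[] /andP[/eqP/= eq_c _].
  (* Both vertices lie in a row outside [A], so [v] is monitored through its column; a second column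
     [z] outside [B] gives another unmonitored neighbour [(i, z)]. *)
  subst x; have jB : j \in B by move: vF; rewrite inE /= (negbTE xA).
  have [z zB neq_zy] := exists_other y cB; rewrite inE in zB.
  have : (i, z) \in nbhd ((i, j) : K) :\: cross A B.
    rewrite !inE /= /cart_adj /= negb_or xA zB eqxx /=.
    by rewrite (memPn zB) // orTb.
  by rewrite E inE xpair_eqE (negbTE neq_zy) andbF.
subst y; have iA : i \in A by move: vF; rewrite inE /= (negbTE yB) orbF.
have [z zA neq_zx] := exists_other x cA; rewrite inE in zA.
have : (z, j) \in nbhd ((i, j) : K) :\: cross A B.
  rewrite !inE /= /cart_adj /= negb_or yB zA eqxx /=.
  by rewrite (memPn zA) // orbT.
by rewrite E inE xpair_eqE (negbTE neq_zx).
Qed.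

Lemma power_dominating_rook_card (S : {set K}) :
  power_dominating S -> (m <= #|S|.+1) || (n <= #|S|.+1).
Proof.
move=> /eqP pdS; apply/negPn/negP; rewrite negb_or -!ltnNge => /andP[ltSm ltSn].
pose A : {set 'I_m} := [set v.1 | v in S].
pose B : {set 'I_n} := [set v.2 | v in S].
have cA : 1 < #|~: A|.
  rewrite cardsCs setCK card_ord ltn_subRL addnC.
  by apply: leq_ltn_trans ltSm; rewrite ltnS leq_imset_card.
have cB : 1 < #|~: B|.
  rewrite cardsCs setCK card_ord ltn_subRL addnC.
  by apply: leq_ltn_trans ltSn; rewrite ltnS leq_imset_card.
(* Where a missed row crosses a missed column, the vertex is never monitored. *)
have /card_gt0P[x xA] := ltnW cA; have /card_gt0P[y yB] := ltnW cB.
have := monitored_sub (closed_nbhd_sub_cross S)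
  (fun v w => cross_stuck v w cA cB).
rewrite pdS => /subsetP/(_ (x, y) (in_setT _)); rewrite !inE in xA yB *.
by rewrite (negbTE xA) (negbTE yB).
Qed.

Lemma rook_connected (x y : K) : connect (@adj K) x y.
Proof.
case: x y => [i j] [k l]; apply: (@connect_trans _ _ (i, l)).
  have [->|neq_jl] := eqVneq j l; first exact: connect0.
  by apply: connect1; rewrite /= /cart_adj /= eqxx neq_jl.
have [->|neq_ik] := eqVneq i k; first exact: connect0.
by apply: connect1; rewrite /= /cart_adj /= eqxx neq_ik orbT.
Qed.

(** The set lies in one column, hence is a clique. The row [i1] meets it and will force the row
    [i0]. *)
Lemma punctured_column_cpd (i0 i1 : 'I_m) (j0 : 'I_n) :
  i1 != i0 ->
  connected_power_dominating (setX [set~ i0] [set j0] : {set K}).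
Proof.
move=> neq_i; set S : {set K} := setX _ _; apply/andP; split; last first.
  apply/forall_inP => -[i j] iS; apply/forall_inP => -[k l] kS.
  have [->|neq_ik] := eqVneq i k.
    by move: iS kS; rewrite !inE /= => /andP[_ /eqP->] /andP[_ /eqP->].
  apply: connect1; rewrite /= iS kS /cart_adj /= neq_ik.
  by move: iS kS; rewrite !inE /= => /andP[_ /eqP->] /andP[_ /eqP->]; rewrite eqxx orbT.
have rowM i j : i != i0 -> ((i, j) : K) \in closed_nbhd S.
  move=> neq; have [->|neq_j] := eqVneq j j0; first by rewrite !inE /= neq eqxx.
  rewrite inE; apply/orP; right; apply/bigcupP; exists (i, j0).
    by rewrite !inE /= neq eqxx.
  by rewrite inE /= /cart_adj /= eqxx eq_sym neq_j.
rewrite /power_dominating eqEsubset subsetT; apply/subsetP => -[i j] _.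
have sM := subsetP (sub_monitored S).
have [->|neq] := eqVneq i i0; last exact/sM/rowM.
apply/negPn/negP => nM.
(* All rows but [i0] are monitored, and [(i1, j)] meets row [i0] only in column [j], so it would
   still force [(i0, j)]. *)
have /negP[] := @monitored_stuck K S (i1, j) (i0, j).
rewrite /forces (sM _ (rowM _ _ neq_i)) /= eqEsubset sub1set in_setD nM.
rewrite inE /= /cart_adj /= eqxx neq_i orbT andbT.
apply/subsetP => -[k l]; rewrite in_setD => /andP[klM].
have {klM} -> : k = i0 by apply: contraNeq klM => neq_k; apply/sM/rowM.
by rewrite !inE /= /cart_adj /= (negbTE neq_i) /= => /andP[/eqP-> _].
Qed.

End RookGraph.

Theorem theorem5 (m n : nat) (hm : 2 <= m) (hmn : m <= n) :
  gammaPc (cartesian (complete m) (complete n)) = m - 1.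
Proof.
(* Connectedness of the grid makes [gammaPc] a true minimum, not the default value. *)
have [[S /andP[pdS _] <-] minS] := gammaPcP (@rook_connected m n).
apply/eqP; rewrite eqn_leq; apply/andP; split; last first.
  rewrite leq_subLR add1n.
  by case/orP: (power_dominating_rook_card _ _ S pdS) => // /(leq_trans hmn).
have m0 : 0 < m := ltnW hm; have n0 : 0 < n := leq_trans m0 hmn.
(* Row 0 is left out and row 1, which exists as [2 <= m], forces it. *)
have cpd := @punctured_column_cpd m n (Ordinal m0) (Ordinal hm) (Ordinal n0) isT.
apply: leq_trans (minS _ cpd) _.
by rewrite cardsX cardsC1 cards1 card_ord muln1 subn1.
Qed.
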